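(* Let $(x_k)_{k\ge 0}$ be the random iterates of the Penalty Sketching (PS) method with fixed penalty $\rho>0$, started at $x_0\in\mathbb{R}^n$. Put $$\mu_{\min}=\lambda_{\min}^+\big(\mathbb{E}_{\mathcal D}[B^{-1/2}ZB^{-1/2}]\big),\qquad \eta_{\max}=\lambda_{\max}\big(\mathbb{E}_{\mathcal D}[B^{-1/2}ZB^{-1/2}]\big),$$ $$\mu_0=\lambda_{\min}\big(B^{-1/2}\,\mathbb{E}_{\mathcal D}[A^\top S H G H S^\top A]\,B^{-1/2}\big).$$ Then $x_k$ converges to $x^*$ in the sense that $\mathbb{E}[\|x_k-x^*\|_B^2]\to 0$, and for every $k\ge 0$ $$\mathbb{E}\big[\|x_{k+1}-x^*\|_B^2\big]\le\Big(1-\mu_{\min}-\frac{\mu_0}{\rho}\Big)^{k+1}\,\mathbb{E}\big[\|x_0-x^*\|_B^2\big],$$ $$\mathbb{E}\big[\|x_{k+1}-x^*\|_{\mathbb{E}_{\mathcal D}[Z]}^2\big]\le\eta_{\max}\Big(1-\mu_{\min}-\frac{\mu_0}{\rho}\Big)^{k+1}\,\mathbb{E}\big[\|x_0-x^*\|_B^2\big].$$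
   Context: Let $A\in\mathbb{R}^{m\times n}$ and $b\in\mathbb{R}^m$ be such that the linear system $Ax=b$ is consistent. Let $B\in\mathbb{R}^{n\times n}$ and $G\in\mathbb{R}^{p\times p}$ be symmetric positive definite. For a symmetric positive semidefinite matrix $M$ write $\|x\|_M^2=x^\top Mx$. $\lambda_{\min}$, $\lambda_{\max}$, $\lambda_{\min}^+$ denote the smallest, largest and smallest nonzero eigenvalue of a symmetric positive semidefinite matrix. $\mathcal D$ is a probability distribution on real $m\times p$ matrices and $\mathbb{E}_{\mathcal D}$ is expectation over $S\sim\mathcal D$ (all expectations used are assumed to exist). For $S\sim\mathcal D$ and $\rho>0$ define $$H=\Big(\tfrac1\rho G+S^\top AB^{-1}A^\top S\Big)^{-1},\quad Z=A^\top SHS^\top A,\quad F=\Big(\tfrac1\rho B+A^\top SG^{-1}S^\top A\Big)^{-1},\quad W=S^\top AFA^\top S.$$ Standing assumption on $\mathcal D$: $\mathrm{Null}(\mathbb{E}_{\mathcal D}[SHS^\top])\subseteq\mathrm{Null}(A^\top)$ and $\mathbb{E}_{\mathcal D}[W]\succ0$. PS method with fixed penalty $\rho$: given $x_0\in\mathbb{R}^n$, at each iteration $k\ge0$ draw a fresh independent sample $S\sim\mathcal D$ and set $$x_{k+1}=x_k-B^{-1}A^\top S\Big(\tfrac1\rho G+S^\top AB^{-1}A^\top S\Big)^{-1}S^\top(Ax_k-b).$$ $\mathbb{E}$ denotes total expectation. $x^*$ is the $B$-norm projection of $x_0$ onto the solution set: $x^*=\arg\min\{\|x-x_0\|_B^2: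 Ax=b\}=x_0-B^{-1}A^\top(AB^{-1}A^\top)^\dagger(Ax_0-b)$. *)

(* Defs.v *)
From HB Require Import structures.
From mathcomp Require Import all_boot all_order all_algebra.
From mathcomp Require Import all_classical all_reals all_analysis.

Set Implicit Arguments.
Unset Strict Implicit.
Unset Printing Implicit Defensive.

Import Order.TTheory GRing.Theory Num.Theory.
Import numFieldNormedType.Exports.

Local Open Scope classical_set_scope.
Local Open Scope ring_scope.

(* ||x||_M ^ 2 when M is positive semidefinite *)
Definition quadform (R : realType) (n : nat) (M : 'M[R]_n) (x : 'cV[R]_n) : R :=
  (x^T *m M *m x) 0 0.

Definition spd (R : realType) (n : nat) (M : 'M[R]_n) : Prop :=
  M^T = M /\ forall x : 'cV[R]_n, x != 0 -> 0 < quadform M x.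

(* M^(-1/2): inverse of the symmetric positive definite square root of M, which
   exists and is unique when M is symmetric positive definite. *)
Definition invsqrtmx (R : realType) (n : nat) (M : 'M[R]_n) : 'M[R]_n :=
  invmx (xget 0 [set C : 'M[R]_n | spd C /\ C *m C = M]).

(* The three functions below are only used on real symmetric matrices of positive
   size, nonzero for [lambda_minp]: there the sets are finite and nonempty, so
   that [inf] and [sup] are a minimum and a maximum.  [eigenvalue] refers to row
   eigenvectors, which give the same eigenvalues as column ones. *)
Definition lambda_min (R : realType) (n : nat) (M : 'M[R]_n) : R :=
  inf [set a : R | eigenvalue M a].

Definition lambda_max (R : realType) (n : nat) (M : 'M[R]_n) : R :=
  sup [set a : R | eigenvalue M a].

Definition lambda_minp (R : realType) (n : nat) (M : 'M[R]_n) : R :=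
  inf [set a : R | eigenvalue M a /\ a != 0].

Definition null_space (R : realType) (m n : nat) (M : 'M[R]_(m, n)) :
    set 'cV[R]_n :=
  [set v | M *m v = 0].

(* Real m x p matrices with their Borel sigma-algebra. *)
Notation borel_mx R m p := (g_sigma_algebraType (@open 'M[R]_(m, p))).

Section expectation_of_matrices.
Context {d : measure_display} {T : measurableType d} {R : realType}.

Definition mx_integrable (D : probability T R) (q r : nat)
    (f : T -> 'M[R]_(q, r)) : Prop :=
  forall i j, D.-integrable setT (EFin \o (fun s => f s i j)).

Definition Emx (D : probability T R) (q r : nat) (f : T -> 'M[R]_(q, r)) :
    'M[R]_(q, r) :=
  \matrix_(i, j) (\int[D]_(s in setT) f s i j).

End expectation_of_matrices.

Definition mutually_independent (d d' : measure_display) (T : measurableType d)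
    (T' : measurableType d') (R : realType) (P : probability T R)
    (X : nat -> {RV P >-> T'}) : Prop :=
  forall (s : seq nat) (E : nat -> set T'),
    uniq s -> (forall i, i \in s -> measurable (E i)) ->
    P (\bigcap_(i in [set` s]) X i @^-1` E i) =
    (\prod_(i <- s) P (X i @^-1` E i))%E.

Section penalty_sketching.
Context {R : realType} {m n p : nat}.
Implicit Types (A : 'M[R]_(m, n)) (b : 'cV[R]_m) (B : 'M[R]_n) (G : 'M[R]_p).
Implicit Types (rho : R) (S : 'M[R]_(m, p)) (x : 'cV[R]_n).

Definition Hmx A B G rho S : 'M[R]_p :=
  invmx (rho^-1 *: G + S^T *m A *m invmx B *m A^T *m S).

Definition SHSmx A B G rho S : 'M[R]_m := S *m Hmx A B G rho S *m S^T.

Definition Zmx A B G rho S : 'M[R]_n :=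
  A^T *m S *m Hmx A B G rho S *m S^T *m A.

Definition Fmx A B G rho S : 'M[R]_n :=
  invmx (rho^-1 *: B + A^T *m S *m invmx G *m S^T *m A).

Definition Wmx A B G rho S : 'M[R]_p :=
  S^T *m A *m Fmx A B G rho S *m A^T *m S.

Definition ZGmx A B G rho S : 'M[R]_n :=
  A^T *m S *m Hmx A B G rho S *m G *m Hmx A B G rho S *m S^T *m A.

Definition ps_step A b B G rho S x : 'cV[R]_n :=
  x - invmx B *m A^T *m S
      *m invmx (rho^-1 *: G + S^T *m A *m invmx B *m A^T *m S)
      *m S^T *m (A *m x - b).

Fixpoint ps_iter A b B G rho (x0 : 'cV[R]_n) (S : nat -> 'M[R]_(m, p))
    (k : nat) : 'cV[R]_n :=
  if k is k'.+1 then ps_step A b B G rho (S k') (ps_iter A b B G rho x0 S k')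
  else x0.

(* argmin { ||x - x0||_B ^ 2 : A x = b }; the minimizer exists and is unique when
   A x = b is consistent and B is symmetric positive definite. *)
Definition Bproj A b B (x0 : 'cV[R]_n) : 'cV[R]_n :=
  xget 0 [set x | A *m x = b /\
    forall y, A *m y = b -> quadform B (x - x0) <= quadform B (y - x0)].

End penalty_sketching.

(* Main.v *)
(* With e_k = x_k - x*, a step of the method reads e_(k+1) = (1 - B^-1 Z) e_k, and
   Z B^-1 Z = Z - ZG / rho, where ZG = A^T S H G H S^T A, turns the B-norm into
     ||e_(k+1)||_B^2 = ||e_k||_B^2 - ||e_k||_Z^2 - ||e_k||_ZG^2 / rho.
   All the e_k lie in the range of B^-1 A^T.  The null space condition makes the
   kernel of E[Z] equal to that of A, so B^(1/2) e_k lies in the range of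
   B^(-1/2) E[Z] B^(-1/2), where the smallest nonzero eigenvalue mu_min bounds the
   Rayleigh quotient from below.  The sample of step k is independent of the
   sigma-algebra generated by the earlier ones, so by Fubini-Tonelli it can be
   averaged out with e_k held fixed, and the expected squared error contracts by
   the factor 1 - mu_min - mu0 / rho, which lies in [0, 1) because A != 0. *)

Require Import Defs.
From HB Require Import structures.
From mathcomp Require Import all_boot all_order all_algebra.
From mathcomp Require Import all_classical all_reals all_analysis.
From mathcomp Require Import measurable_realfun ring lra complex.

Import Order.TTheory GRing.Theory Num.Theory.
Import numFieldNormedType.Exports.

Local Open Scope classical_set_scope.
Local Open Scope ring_scope.

(** * Quadratic forms and spectra *)

Section quadratic_forms.
Context {R : realType}.

Lemma quadform_mulmx {n q : nat} (M : 'M[R]_q) (K : 'M[R]_(q, n)) (v : 'cV[R]_n) :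
  quadform M (K *m v) = quadform (K^T *m M *m K) v.
Proof. by rewrite /quadform trmx_mul !mulmxA. Qed.

Lemma quadform1 {n : nat} (v : 'cV[R]_n) : quadform 1%:M v = \sum_i v i 0 ^+ 2.
Proof.
rewrite /quadform mulmx1 mxE; apply: eq_bigr => i _.
by rewrite !mxE expr2.
Qed.

Lemma quadform1_ge0 {n : nat} (v : 'cV[R]_n) : 0 <= quadform 1%:M v.
Proof. by rewrite quadform1 sumr_ge0// => i _; rewrite sqr_ge0. Qed.

Lemma quadform1_eq0 {n : nat} (v : 'cV[R]_n) : (quadform 1%:M v == 0) = (v == 0).
Proof.
apply/idP/eqP => [|->]; last by rewrite /quadform mulmx0 mxE.
rewrite quadform1 psumr_eq0 => [/allP v0|i _]; last exact: sqr_ge0.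
apply/colP => i; rewrite mxE; apply/eqP.
by rewrite -(sqrf_eq0 (v i 0)); exact: v0 (mem_index_enum i).
Qed.

Lemma quadformD {n : nat} (M N : 'M[R]_n) (v : 'cV[R]_n) :
  quadform (M + N) v = quadform M v + quadform N v.
Proof. by rewrite /quadform mulmxDr mulmxDl mxE. Qed.

Lemma quadformZ {n : nat} (a : R) (M : 'M[R]_n) (v : 'cV[R]_n) :
  quadform (a *: M) v = a * quadform M v.
Proof. by rewrite /quadform -scalemxAr -scalemxAl mxE. Qed.

Lemma quadformN {n : nat} (M : 'M[R]_n) (v : 'cV[R]_n) :
  quadform (- M) v = - quadform M v.
Proof. by rewrite -scaleN1r quadformZ mulN1r. Qed.

Lemma quadform0r {n : nat} (M : 'M[R]_n) : quadform M 0 = 0.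
Proof. by rewrite /quadform mulmx0 mxE. Qed.

Lemma form_sym {n : nat} (M : 'M[R]_n) (u v : 'cV[R]_n) :
  (u^T *m M *m v) 0 0 = (v^T *m M^T *m u) 0 0.
Proof.
have <- : (u^T *m M *m v)^T 0 0 = (u^T *m M *m v) 0 0 by rewrite mxE.
by rewrite !trmx_mul trmxK mulmxA.
Qed.

Lemma quadformDr {n : nat} (M : 'M[R]_n) (u v : 'cV[R]_n) : M^T = M ->
  quadform M (u + v) = quadform M u + quadform M v + 2 * (u^T *m M *m v) 0 0.
Proof.
move=> Msym; have DE (X Y : 'M[R]_1) : (X + Y) 0 0 = X 0 0 + Y 0 0 by rewrite mxE.
rewrite /quadform [(u + v)^T]raddfD/= !(mulmxDl, mulmxDr) !DE.
have -> : (v^T *m M *m u) 0 0 = (u^T *m M *m v) 0 0.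
  by rewrite form_sym Msym.
ring.
Qed.

Lemma quadformE {n : nat} (M : 'M[R]_n) (v : 'cV[R]_n) :
  quadform M v = \sum_i \sum_j M i j * (v i 0 * v j 0).
Proof.
rewrite /quadform -mulmxA mxE; apply: eq_bigr => i _.
rewrite !mxE mulr_sumr; apply: eq_bigr => j _.
by rewrite mulrCA mulrA.
Qed.

End quadratic_forms.

(** * Spectral decomposition of real symmetric matrices *)

Section spectrum.
Local Open Scope sesquilinear_scope.
Context {R : realType} {n : nat} (M : 'M[R]_n.+1) (Msym : M^T = M).

(* [d] lists the eigenvalues and [c v i] is the squared modulus of the [i]-th
   coordinate of [v] in a unitary eigenbasis over [R[i]]. *)
Lemma sym_spectrum :
  exists (d : 'I_n.+1 -> R) (c : 'cV[R]_n.+1 -> 'I_n.+1 -> R),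
  [/\ forall v i, 0 <= c v i,
      forall i, eigenvalue M (d i) &
      forall (q : {poly R}) v,
        quadform (horner_mx M q) v = \sum_i q.[d i] * c v i].
Proof.
(* The complexified matrix [MC] is Hermitian, hence unitarily diagonalizable over [R[i]] with a real
   spectrum; [d] is that spectrum read in [R]. *)
pose f : {rmorphism R -> R[i]} := real_complex R.
have fJ x : (f x)^* = f x by rewrite conj_Creal//; apply/complex_realP; exists x.
pose MC := map_mx f M; pose U := spectralmx MC; pose s := spectral_diag MC.
have MCh : MC \is hermsymmx.
  apply: realsym_hermsym.
    by apply/is_hermitianmxP; rewrite expr0 scale1r map_mx_id// map_trmx Msym.
  by apply/mxOverP => i j; rewrite mxE; apply/complex_realP; exists (M i j).
have MCE : MC = invmx U *m diag_mx s *m U.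
  by apply/orthomx_spectralP/hermitian_normalmx.
have UU := spectral_unitarymx MC; have Uu := spectral_unit MC.
pose d i := complex.Re (s 0 i).
have dE i : f (d i) = s 0 i.
  by apply: RRe_real; have /mxOverP := hermitian_spectral_diag_real MCh; apply.
exists d, (fun v i => complex.Re (`|(U *m map_mx f v) i 0| ^+ 2)); split.
- by move=> v i; rewrite -add_Re2_Im2 /= addr_ge0// sqr_ge0.
(* The eigenvector found, row [i] of [U], is complex. Being a root of the characteristic polynomial
   descends from [R[i]] to [R], so no real eigenvector has to be exhibited. *)
- move=> i; rewrite eigenvalue_root_char -(fmorph_root f) map_char_poly/=.
  rewrite -eigenvalue_root_char -/MC.
  apply/eigenvalueP; exists (row i U).
    rewrite {1}MCE !mulmxA -row_mul mulmxV// row1.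
    rewrite -rowE row_diag_mx -scalemxAl -rowE [s 0 i]/=.
    by rewrite -dE.
  apply/eqP => Ui0; have := Uu; rewrite -row_free_unit.
  move/row_freeP => [V] /(congr1 (row i)); rewrite row_mul Ui0 mul0mx row1.
  by move=> /rowP/(_ i); rewrite !mxE !eqxx => /eqP; rewrite eq_sym oner_eq0.
move=> q v; apply: (@complexI R).
change (f (quadform (horner_mx M q) v) =
  f (\sum_i q.[d i] * complex.Re (`|(U *m map_mx f v) i 0| ^+ 2))).
rewrite rmorph_sum/=.
have -> : f (quadform (horner_mx M q) v) =
    ((map_mx f v)^T *m horner_mx MC (map_poly f q) *m map_mx f v) 0 0.
  by rewrite -map_horner_mx map_trmx -!map_mxM [RHS]mxE.
have -> : horner_mx MC (map_poly f q) =
    invmx U *m horner_mx (diag_mx s) (map_poly f q) *m U.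
  by rewrite MCE -horner_mx_uconjC.
rewrite horner_mx_diag invmx_unitary//.
set w := map_mx f v.
(* Since [w] has real entries, its transpose is its conjugate transpose, and the form becomes a
   diagonal one in the coordinates [U *m w]. *)
have -> : w^T *m (U ^t* *m diag_mx (map_mx (horner (map_poly f q)) s) *m U) *m w
    = (U *m w) ^t* *m diag_mx (map_mx (horner (map_poly f q)) s) *m (U *m w).
  have -> : (U *m w) ^t* = w^T *m U ^t*.
    rewrite trmx_mul map_mxM; have -> // : w ^t* = w^T.
    by apply/matrixP => i j; rewrite 3!mxE fJ.
  by rewrite !mulmxA.
rewrite mul_mx_diag !mxE; apply: eq_bigr => i _.
set z := (U *m w) i 0.
rewrite mxE [in X in X * _ * _]mxE [in X in X * _ * _]mxE -/z.
rewrite [in X in _ * X * _]mxE -dE horner_map/= (rmorphM f).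
have -> : f (complex.Re (`|z| ^+ 2)) = `|z| ^+ 2.
  by apply: RRe_real; rewrite ger0_real// exprn_ge0.
by rewrite normCK mulrAC mulrC [z * _]mulrC.
Qed.
End spectrum.

(** * Semidefinite matrices, square roots and Rayleigh quotients *)

Definition psd {R : realType} {n : nat} (M : 'M[R]_n) : Prop :=
  M^T = M /\ forall v : 'cV[R]_n, 0 <= quadform M v.

(** Newton's scheme: a new node [a] is fitted by adding a multiple of the polynomial that vanishes
    on the earlier nodes, which keeps their values. *)
Lemma interpolation {F : fieldType} (s : seq F) (g : F -> F) :
  exists q : {poly F}, {in s, forall a, q.[a] = g a}.
Proof.
elim: s => [|a s [q qs]]; first by exists 0.
have [sa|sa] := boolP (a \in s).
  by exists q => b /[!inE]/predU1P[->|/qs//]; exact: qs.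
pose P := \prod_(b <- s) ('X - b%:P).
have Pa : P.[a] != 0 by rewrite -/(root P a) root_prod_XsubC.
exists (q + ((g a - q.[a]) / P.[a]) *: P) => b /[!inE]; rewrite hornerD hornerZ.
have [->|_ /= sb] := eqVneq b a; first by rewrite divfK// addrC subrK.
have /eqP-> : root P b by rewrite root_prod_XsubC.
by rewrite mulr0 addr0 qs.
Qed.

Section semidefinite.
Context {R : realType}.

Lemma spd_psd {n : nat} (M : 'M[R]_n) : spd M -> psd M.
Proof.
move=> [Msym Mpos]; split=> // v; have [->|/Mpos/ltW//] := eqVneq v 0.
by rewrite quadform0r.
Qed.

(* Minimising [q (w + t v)] over [t] at a zero [v] of the form kills the linear term. *)
Lemma psd_eq0 {n : nat} (M : 'M[R]_n) (v : 'cV[R]_n) :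
  psd M -> quadform M v = 0 -> M *m v = 0.
Proof.
move=> [Msym Mpos] v0; apply/eqP; rewrite -quadform1_eq0.
set w := M *m v; apply/negPn/negP => w0.
have wpos : 0 < quadform 1%:M w by rewrite lt0r w0 quadform1_ge0.
have cross : (v^T *m M *m w) 0 0 = quadform 1%:M w.
  by rewrite form_sym Msym /quadform mulmx1 -mulmxA.
have e t : quadform M (v + t *: w) = t ^+ 2 * quadform M w + 2 * t * quadform 1%:M w.
  rewrite quadformDr// v0 add0r; congr (_ + _).
    by rewrite /quadform -scalemxAr mxE [(t *: w)^T]linearZ/= -!scalemxAl mxE mulrA expr2.
  by rewrite -scalemxAr mxE cross mulrA.
have a0 : 0 <= quadform M w by exact: Mpos.
(* The [+ 1] keeps [a] positive when the form vanishes at [w]. At [t = - b / a] the form is a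
   positive square times [quadform M w - 2 * a], which is negative. *)
pose a := quadform M w + 1; have apos : 0 < a by rewrite /a; lra.
have := Mpos (v - (quadform 1%:M w / a) *: w); rewrite -scaleNr e.
set b := quadform 1%:M w in wpos *.
have -> : (- (b / a)) ^+ 2 * quadform M w + 2 * - (b / a) * b
   = (b / a) ^+ 2 * (quadform M w - 2 * a).
  by field; rewrite gt_eqF.
apply/negP; rewrite -ltNge pmulr_rlt0 ?exprn_gt0 ?divr_gt0// /a; lra.
Qed.

Lemma spd_unitmx {n : nat} (M : 'M[R]_n) : spd M -> M \in unitmx.
Proof.
move=> [Msym Mpos]; rewrite -row_free_unit; apply/inj_row_free => v vM.
apply/eqP/negPn/negP => v0.
have := Mpos v^T; rewrite trmx_eq0 => /(_ v0).
by rewrite /quadform trmxK vM mul0mx mxE ltxx.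
Qed.

Lemma invmx_sym {n : nat} (M : 'M[R]_n) : M^T = M -> (invmx M)^T = invmx M.
Proof. by move=> Msym; rewrite trmx_inv Msym. Qed.

Lemma spd_inv {n : nat} (M : 'M[R]_n) : spd M -> spd (invmx M).
Proof.
move=> sM; have Mu := spd_unitmx _ sM; have [Msym Mpos] := sM.
split=> [|v v0]; first exact: invmx_sym.
have -> : quadform (invmx M) v = quadform M (invmx M *m v).
  by rewrite quadform_mulmx invmx_sym// mulVmx// mul1mx.
apply: Mpos; apply: contra_neq v0 => Mv0.
by rewrite -(mulKVmx Mu v) Mv0 mulmx0.
Qed.

Lemma psd_mulmx {n q : nat} (M : 'M[R]_n) (K : 'M[R]_(n, q)) :
  psd M -> psd (K^T *m M *m K).
Proof.
move=> [Msym Mpos]; split=> [|v]; last by rewrite -quadform_mulmx.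
by rewrite !trmx_mul trmxK Msym mulmxA.
Qed.

Lemma psd_zero {n : nat} (M : 'M[R]_n) :
  M^T = M -> (forall v, quadform M v = 0) -> M = 0.
Proof.
move=> Msym M0; have pM : psd M by split=> // v; rewrite M0.
apply/matrixP => i j; have := psd_eq0 _ (delta_mx j 0) pM (M0 _).
by rewrite -colE => /colP/(_ i); rewrite !mxE.
Qed.

(** Inclusion of kernels dualizes to inclusion of row spaces: [N], hence [K], kills the columns of
    [cokermx N]. *)
Lemma row_factor {m n q : nat} (N : 'M[R]_(m, n)) (K : 'M[R]_(q, n)) :
  (forall v : 'cV[R]_n, N *m v = 0 -> K *m v = 0) -> exists Y, K = Y *m N.
Proof.
move=> NK; have /submxP[Y ->] : (K <= N)%MS; last by exists Y.
rewrite submxE; apply/eqP/matrixP => i j; rewrite [RHS]mxE.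
have := NK (cokermx N *m delta_mx j 0); rewrite mulmxA mulmx_coker mul0mx => /(_ erefl).
by rewrite mulmxA -colE => /colP/(_ i); rewrite mxE [RHS]mxE.
Qed.

Lemma horner_mx_sym {n : nat} (M : 'M[R]_n.+1) (q : {poly R}) :
  M^T = M -> (horner_mx M q)^T = horner_mx M q.
Proof.
move=> Msym; elim/poly_ind: q => [|q c IH]; first by rewrite rmorph0 trmx0.
rewrite rmorphD rmorphM/= horner_mx_X horner_mx_C raddfD/= tr_scalar_mx.
by rewrite trmx_mul IH Msym; congr (_ + _); apply: comm_mx_horner.
Qed.

Lemma eigenvalue_psd_ge0 {n : nat} (M : 'M[R]_n) (a : R) :
  psd M -> eigenvalue M a -> 0 <= a.
Proof.
move=> [_ Mpos] /eigenvalueP[v vM v0].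
have := Mpos v^T; rewrite /quadform trmxK vM -scalemxAl mxE.
have := quadform1_ge0 v^T; have := quadform1_eq0 v^T.
rewrite trmx_eq0 (negbTE v0) /quadform trmxK mulmx1 => /negbT x0 x1.
by rewrite pmulr_lge0// lt0r x0.
Qed.

Lemma eigenvalue_spd_gt0 {n : nat} (M : 'M[R]_n) (a : R) :
  spd M -> eigenvalue M a -> 0 < a.
Proof.
move=> sM Ma; rewrite lt0r (eigenvalue_psd_ge0 _ _ (spd_psd _ sM) Ma) andbT.
have [_ Mpos] := sM; have /eigenvalueP[v vM v0] := Ma.
apply: contraTneq isT => a0; have := Mpos v^T.
by rewrite trmx_eq0 /quadform trmxK vM a0 scale0r mul0mx mxE ltxx => /(_ v0).
Qed.

(* The root is [q(M)] for a polynomial [q] interpolating the square root at the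
   eigenvalues of [M]. *)
Lemma spd_sqrt {n : nat} (M : 'M[R]_n.+1) :
  spd M -> exists C : 'M[R]_n.+1, spd C /\ C *m C = M.
Proof.
move=> sM; have [Msym Mpos] := sM; have [d [c [c0 dM MdE]]] := sym_spectrum _ Msym.
have dpos i : 0 < d i by exact: eigenvalue_spd_gt0 (dM i).
have [q qd] : exists q : {poly R}, forall i, q.[d i] = Num.sqrt (d i).
  have [q qs] := interpolation [seq d i | i : 'I_n.+1] Num.sqrt.
  by exists q => i; apply: qs; apply/mapP; exists i; rewrite ?mem_enum.
have Csym := horner_mx_sym _ q Msym; exists (horner_mx M q); split.
  split=> // v v0; rewrite MdE; under eq_bigr do rewrite qd.
  have cE : quadform 1%:M v = \sum_i c v i.
    by rewrite -(horner_mx_C M) MdE; apply: eq_bigr => i _; rewrite hornerC mul1r.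
  rewrite lt0r sumr_ge0 ?andbT => [|i _]; last by rewrite mulr_ge0// sqrtr_ge0.
  apply: contra v0; rewrite psumr_eq0 => [/allP h|i _]; last first.
    by rewrite mulr_ge0// sqrtr_ge0.
  rewrite -quadform1_eq0 cE big1// => i _; have := h i (mem_index_enum i).
  by rewrite mulf_eq0 gt_eqF ?sqrtr_gt0//= => /eqP.
apply/eqP; rewrite -subr_eq0; apply/eqP.
have -> : horner_mx M q *m horner_mx M q - M = horner_mx M (q ^+ 2 - 'X).
  by rewrite rmorphB rmorphXn/= horner_mx_X expr2.
apply: psd_zero => [|v]; first exact: horner_mx_sym.
rewrite MdE big1// => i _; rewrite !hornerE qd sqr_sqrtr ?subrr ?mul0r//.
exact: ltW.
Qed.

Section lambda.
Context {n : nat} (M : 'M[R]_n.+1) (Msym : M^T = M).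

(** The list [d] is exhaustive: at an eigenvector for [a] the form of [(M - a) ^ 2] vanishes, so all
    coordinates with [d i != a] are zero, yet some coordinate is not. *)
Lemma sym_eigenvalues : exists (d : 'I_n.+1 -> R) (c : 'cV[R]_n.+1 -> 'I_n.+1 -> R),
  [/\ forall v i, 0 <= c v i,
      forall i, eigenvalue M (d i),
      forall a, eigenvalue M a -> exists i, a = d i &
      forall (q : {poly R}) v,
        quadform (horner_mx M q) v = \sum_i q.[d i] * c v i].
Proof.
have [d [c [c0 dM MdE]]] := sym_spectrum _ Msym; exists d, c; split=> // a.
move=> /eigenvalueP[v vM v0].
have e : quadform (horner_mx M (('X - a%:P) ^+ 2)) v^T = 0.
  rewrite expr2 rmorphM rmorphB/= horner_mx_X horner_mx_C /quadform trmxK.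
  have va : v *m (M - a%:M) = 0 by rewrite mulmxBr vM mul_mx_scalar subrr.
  by rewrite (mulmxA v (M - a%:M)) va !mul0mx mxE.
have [c1|] := eqVneq (quadform 1%:M v^T) 0.
  by move/eqP: c1; rewrite quadform1_eq0 trmx_eq0 (negbTE v0).
have cE : quadform 1%:M v^T = \sum_i c v^T i.
  by rewrite -(horner_mx_C M) MdE; apply: eq_bigr => i _; rewrite hornerC mul1r.
rewrite cE => c1; move: e; rewrite MdE => /eqP.
rewrite psumr_eq0 => [/allP h|i _]; last first.
  by rewrite !hornerE mulr_ge0// sqr_ge0.
have [/existsP[i /eqP->]|] := boolP [exists i, a == d i]; first by exists i.
rewrite negb_exists => /forallP ad; case/negP: c1; rewrite big1// => i _.
have := h i (mem_index_enum i); rewrite !hornerE mulf_eq0 sqrf_eq0 subr_eq0 eq_sym.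
by rewrite (negbTE (ad i)) => /eqP.
Qed.

Lemma lambda_max_quadform (v : 'cV[R]_n.+1) :
  quadform M v <= lambda_max M * quadform 1%:M v.
Proof.
have [d [c [c0 dM Md MdE]]] := sym_eigenvalues.
have := MdE 'X v; have := MdE 1%:P v; rewrite horner_mx_X horner_mx_C => -> ->.
rewrite mulr_sumr; apply: ler_sum => i _; rewrite hornerX hornerC mul1r ler_wpM2r//.
apply: ub_le_sup; last exact: dM.
(* A real [sup] bounds its set only if the set has an upper bound; this sum dominates every
   eigenvalue. *)
exists (\sum_i `|d i|) => _ /Md[j ->]; rewrite (bigD1 j)//=.
by rewrite (le_trans (ler_norm _))// lerDl sumr_ge0.
Qed.

Lemma lambda_min_quadform (v : 'cV[R]_n.+1) :
  lambda_min M * quadform 1%:M v <= quadform M v.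
Proof.
have [d [c [c0 dM Md MdE]]] := sym_eigenvalues.
have := MdE 'X v; have := MdE 1%:P v; rewrite horner_mx_X horner_mx_C => -> ->.
rewrite mulr_sumr; apply: ler_sum => i _; rewrite hornerX hornerC mul1r ler_wpM2r//.
apply: ge_inf; last exact: dM.
exists (- \sum_i `|d i|) => _ /Md[j ->]; rewrite (bigD1 j)//= lerNl.
by rewrite (le_trans (ler_norm _))// normrN lerDl sumr_ge0.
Qed.

(** Absorbing [M] turns both sides into forms at [u] of [M ^ 2] and [M ^ 3], and the claim becomes
    [lambda_minp M * d i ^ 2 <= d i ^ 3] in each coordinate. *)
Lemma lambda_minp_quadform (u : 'cV[R]_n.+1) :
  lambda_minp M * quadform 1%:M (M *m u) <= quadform M (M *m u).
Proof.
have [d [c [c0 dM Md MdE]]] := sym_eigenvalues.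
rewrite !quadform_mulmx Msym mulmx1.
have E k : horner_mx M ('X ^+ k) = M ^+ k by rewrite rmorphXn/= horner_mx_X.
have -> : M *m M = horner_mx M ('X ^+ 2) by rewrite E expr2.
have -> : horner_mx M ('X ^+ 2) *m M = horner_mx M ('X ^+ 3) by rewrite !E [RHS]exprSr.
(* Zero eigenvalues do not contribute: coordinate [i] of [M *m u] has factor [d i]. *)
rewrite !MdE mulr_sumr; apply: ler_sum => i _; rewrite !hornerXn mulrA.
have [->|di] := eqVneq (d i) 0; first by rewrite !expr0n !(mulr0, mul0r).
rewrite ler_wpM2r// [leRHS]exprS ler_wpM2r ?sqr_ge0//.
apply: ge_inf; last by split; first exact: dM.
exists (- \sum_i `|d i|) => _ [/Md[j ->] _]; rewrite (bigD1 j)//= lerNl.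
by rewrite (le_trans (ler_norm _))// normrN lerDl sumr_ge0.
Qed.
End lambda.

Lemma lambda_min_ge0 {n : nat} (M : 'M[R]_n.+1) : psd M -> 0 <= lambda_min M.
Proof.
move=> pM; have [d [c [c0 dM Md MdE]]] := sym_eigenvalues _ pM.1.
apply: lb_le_inf; first by exists (d ord0); exact: dM.
by move=> a; exact: eigenvalue_psd_ge0.
Qed.

(** If every [d i] were zero, the form of [M], and so [M], would vanish. The infimum is therefore
    over a nonempty set, and the least nonzero [d i] bounds it from below. *)
Lemma lambda_minp_gt0 {n : nat} (M : 'M[R]_n.+1) :
  psd M -> M != 0 -> 0 < lambda_minp M.
Proof.
move=> pM M0; have [d [c [c0 dM Md MdE]]] := sym_eigenvalues _ pM.1.
have [/existsP[k dk]|] := boolP [exists i, d i != 0]; last first.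
  rewrite negb_exists => /forallP d0; case/negP: M0; apply/eqP.
  apply: psd_zero => [|v]; first exact: pM.1.
  rewrite -(horner_mx_X M) MdE big1// => i _; have := d0 i.
  by rewrite negbK hornerX => /eqP->; rewrite mul0r.
have [i di dmin] : exists2 i, d i != 0 & forall j, d j != 0 -> d i <= d j.
  by case: (@arg_minP _ R _ k (fun i => d i != 0) d dk) => i di imin; exists i.
apply: (@lt_le_trans _ _ (d i)).
  by rewrite lt0r di (eigenvalue_psd_ge0 _ _ pM).
apply: lb_le_inf; first by exists (d k); split; first exact: dM.
by move=> _ [/Md[j ->]]; exact: dmin.
Qed.

(** A root exists, so the choice inside [invsqrtmx] returns a genuine one and not the default 0. *)
Lemma invsqrtmxE {n : nat} (B : 'M[R]_n.+1) : spd B ->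
  exists C : 'M[R]_n.+1, [/\ spd C, C *m C = B & invsqrtmx B = invmx C].
Proof.
move=> /spd_sqrt exC; rewrite /invsqrtmx.
set X := [set C | _]; have [/= ? ?] : X (xget 0 X).
  by case: exC => C XC; apply: (xgetPex 0); exists C.
by exists (xget 0 X).
Qed.

(** The Rayleigh quotient of the all-ones vector is nonnegative and at most [lambda_max M]. *)
Lemma lambda_max_ge0 {n : nat} (M : 'M[R]_n.+1) : psd M -> 0 <= lambda_max M.
Proof.
move=> pM; pose v : 'cV[R]_n.+1 := const_mx 1.
have v0 : 0 < quadform 1%:M v.
  rewrite lt0r quadform1_ge0 quadform1_eq0 andbT; apply/eqP => /colP/(_ ord0).
  by rewrite !mxE => /eqP; rewrite oner_eq0.
by rewrite -(pmulr_lge0 _ v0) (le_trans (pM.2 v))// lambda_max_quadform// pM.1.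
Qed.

Lemma spdZ {n : nat} (a : R) (M : 'M[R]_n) : 0 < a -> spd M -> spd (a *: M).
Proof.
move=> a0 [Msym Mpos]; split=> [|v v0]; first by rewrite linearZ/= Msym.
by rewrite quadformZ mulr_gt0// Mpos.
Qed.

Lemma spdD_psd {n : nat} (M N : 'M[R]_n) : spd M -> psd N -> spd (M + N).
Proof.
move=> [Msym Mpos] [Nsym Npos]; split=> [|v v0]; first by rewrite raddfD/= Msym Nsym.
by rewrite quadformD ltr_wpDr// Mpos.
Qed.

Lemma quadform_orth {n : nat} (M : 'M[R]_n) (u v : 'cV[R]_n) : M^T = M ->
  u^T *m M *m v = 0 -> quadform M (u + v) = quadform M u + quadform M v.
Proof. by move=> Msym uv; rewrite quadformDr// uv mxE mulr0 addr0. Qed.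

End semidefinite.

(** * One step of the method *)

Section sketch.
Context {R : realType} {m n p : nat}.
Variables (A : 'M[R]_(m, n)) (B : 'M[R]_n) (G : 'M[R]_p) (rho : R).
Hypotheses (spdB : spd B) (spdG : spd G) (rho_gt0 : 0 < rho).
Implicit Types (S : 'M[R]_(m, p)) (x : 'cV[R]_n).

Local Notation H := (Hmx A B G rho).
Local Notation Z := (Zmx A B G rho).
Local Notation ZG := (ZGmx A B G rho).

(** Makes the [invmx] in [Hmx] a true inverse: [G / rho] is definite, and the other term is a
    congruence of [invmx B]. *)
Lemma spd_sketch S : spd (rho^-1 *: G + S^T *m A *m invmx B *m A^T *m S).
Proof.
apply: spdD_psd; first by apply: spdZ; rewrite ?invr_gt0.
have := psd_mulmx _ (A^T *m S) (spd_psd _ (spd_inv _ spdB)).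
by rewrite trmx_mul trmxK !mulmxA.
Qed.

Lemma spd_H S : spd (H S).
Proof. exact/spd_inv/spd_sketch. Qed.

Lemma psd_SHS S : psd (SHSmx A B G rho S).
Proof. by have := psd_mulmx _ S^T (spd_psd _ (spd_H S)); rewrite trmxK. Qed.

Lemma ZE S : Z S = A^T *m SHSmx A B G rho S *m A.
Proof. by rewrite /Zmx /SHSmx !mulmxA. Qed.

Lemma psd_Z S : psd (Z S).
Proof. by rewrite ZE; apply/psd_mulmx/psd_SHS. Qed.

Lemma psd_ZG S : psd (ZG S).
Proof.
have := psd_mulmx _ (H S *m S^T *m A) (spd_psd _ spdG).
by rewrite !trmx_mul trmxK (spd_H S).1 !mulmxA.
Qed.

Lemma ps_step_error b S x xs : A *m xs = b ->
  ps_step A b B G rho S x - xs = (1%:M - invmx B *m Z S) *m (x - xs).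
Proof.
move=> <-; rewrite /ps_step -mulmxBr mulmxBl mul1mx addrAC /Zmx.
by rewrite !mulmxA.
Qed.

(* [Z B^-1 Z = A^T S H (H^-1 - G / rho) H S^T A = Z - ZG / rho]. *)
Lemma Z_invB_Z S : Z S *m invmx B *m Z S = Z S - rho^-1 *: ZG S.
Proof.
have Hu := spd_unitmx _ (spd_sketch S).
have -> : Z S *m invmx B *m Z S =
  A^T *m S *m H S *m (S^T *m A *m invmx B *m A^T *m S) *m H S *m S^T *m A.
  by rewrite /Zmx !mulmxA.
have -> : S^T *m A *m invmx B *m A^T *m S = invmx (H S) - rho^-1 *: G.
  by rewrite invmxK addrAC subrr add0r.
rewrite mulmxBr !mulmxBl; congr (_ - _).
  by rewrite mulmxK ?unitmx_inv.
by rewrite -scalemxAr -!scalemxAl.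
Qed.

(** The matrix [(1 - Z B^-1) B (1 - B^-1 Z)] expands to [B - 2 Z + Z B^-1 Z], and [Z_invB_Z]
    rewrites its last term. *)
Lemma ps_error_quadform S x :
  quadform B ((1%:M - invmx B *m Z S) *m x) =
  quadform B x - quadform (Z S) x - rho^-1 * quadform (ZG S) x.
Proof.
have Bu := spd_unitmx _ spdB.
rewrite quadform_mulmx [(1%:M - _)^T]raddfB/= trmx1 trmx_mul (psd_Z S).1.
rewrite invmx_sym ?spdB.1//.
rewrite -quadformZ -!quadformN -!quadformD; congr quadform.
rewrite mulmxBl mul1mx mulmxKV// mulmxBr mulmx1 !mulmxBl.
by rewrite mulKVmx// mulmxA Z_invB_Z subKr.
Qed.

End sketch.

(** * The [B]-norm projection onto the solution set *)

Section projection.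
Context {R : realType} {m n : nat}.
Variables (A : 'M[R]_(m, n)) (b : 'cV[R]_m) (B : 'M[R]_n) (spdB : spd B).

(** A solution [xh] with [x0 - xh] in the range of [B^-1 A^T] is [B]-orthogonal to the solution set
    as seen from [x0]; by Pythagoras it is the only minimizer. *)
Lemma Bproj_spec (x0 : 'cV[R]_n) : (exists x, A *m x = b) ->
  A *m Bproj A b B x0 = b /\
  exists y, x0 - Bproj A b B x0 = invmx B *m A^T *m y.
Proof.
move=> [xs xsb]; have Bu := spd_unitmx _ spdB; have [Bsym Bpos] := spdB.
have [Bisym Bipos] := spd_inv _ spdB.
pose N := A *m invmx B *m A^T.
have Nsym : N^T = N by rewrite /N !trmx_mul trmxK Bisym mulmxA.
(* If [N v = 0], the form of [B^-1] vanishes at [A^T v], so [A^T v = 0]. The resulting [Y^T] plays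
   the role of [N^+ A], with [N^+] the pseudoinverse. *)
have [Y YE] : exists Y, A^T = Y *m N.
  apply: row_factor => v Nv; apply/eqP/negPn/negP => /Bipos.
  by rewrite quadform_mulmx trmxK -/N /quadform -mulmxA Nv mulmx0 mxE ltxx.
have {}YE : A = N *m Y^T by rewrite -[LHS]trmxK YE trmx_mul Nsym.
pose y := Y^T *m (x0 - xs); pose xh : 'cV[R]_n := x0 - invmx B *m A^T *m y.
have Axh : A *m xh = b.
  by rewrite mulmxBr !mulmxA -/N -YE -xsb mulmxBr subKr.
have pyth z : A *m z = b ->
    quadform B (z - x0) = quadform B (z - xh) + quadform B (xh - x0).
  move=> Az; have -> : z - x0 = (z - xh) + (xh - x0) by rewrite addrA subrK.
  apply: quadform_orth => //.
  have -> : xh - x0 = - (invmx B *m A^T *m y) by rewrite /xh addrAC subrr add0r.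
  rewrite mulmxN -!mulmxA mulKVmx// mulmxA -trmx_mul mulmxBr Az Axh subrr.
  by rewrite trmx0 mul0mx oppr0.
have pos v : 0 <= quadform B v by case: (spd_psd _ spdB).
rewrite /Bproj; set X := [set x | _].
have /= [Axp xpmin] : X (xget 0 X).
  apply: (@xgetPex _ 0 X); exists xh; split=> // z Az.
  by rewrite (pyth z)// lerDr.
suff -> : xget 0 X = xh.
  by split=> //; exists y; rewrite /xh opprB addrC subrK.
apply/eqP; rewrite -subr_eq0; apply/negPn/negP => /Bpos.
by have := xpmin _ Axh; rewrite [leLHS]pyth// gerDr leNgt => /negbTE ->.
Qed.

End projection.

(** * Expectations and independence *)

Section matrix_expectation.
Context {d : measure_display} {T : measurableType d} {R : realType}.
Variable D : probability T R.

(** Integrability is returned with the value so that the lemma can be iterated on double sums. *)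
Lemma Rintegral_sum (I : Type) (s : seq I) (F : I -> T -> R) :
  (forall i, D.-integrable setT (EFin \o F i)) ->
  D.-integrable setT (EFin \o (fun x => \sum_(i <- s) F i x)) /\
  \int[D]_(x in setT) (\sum_(i <- s) F i x) = \sum_(i <- s) \int[D]_(x in setT) F i x.
Proof.
move=> intF; elim: s => [|i s [intS IH]].
  under [X in _.-integrable _ (_ \o X)]eq_fun do rewrite big_nil.
  under eq_Rintegral do rewrite big_nil.
  rewrite big_nil Rintegral_cst//= mul0r; split=> //; exact: integrable0.
under [X in _.-integrable _ (_ \o X)]eq_fun do rewrite big_cons.
under eq_Rintegral do rewrite big_cons.
rewrite big_cons RintegralD// IH; split=> //.
exact: integrableD (intF i) intS.
Qed.

Lemma Emx_mulmx {a q r c : nat} (K : 'M[R]_(a, q)) (L : 'M[R]_(r, c))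
    (f : T -> 'M[R]_(q, r)) : mx_integrable D f ->
  Emx D (fun s => K *m f s *m L) = K *m Emx D f *m L.
Proof.
move=> intf.
have intK i l k j : D.-integrable setT (EFin \o (fun s => K i l * f s l k * L k j)).
  exact: integrableZr (integrableZl _ _ (intf l k)).
apply/matrixP => i j; rewrite mxE.
transitivity (\int[D]_(s in setT) (\sum_k \sum_l K i l * f s l k * L k j)).
  apply: eq_Rintegral => s _; rewrite mxE; apply: eq_bigr => k _.
  by rewrite mxE mulr_suml.
have intKs k := Rintegral_sum _ (index_enum _) _ (fun l => intK i l k j).
rewrite (Rintegral_sum _ _ _ (fun k => (intKs k).1)).2 mxE; apply: eq_bigr => k _.
rewrite (intKs k).2 mxE mulr_suml; apply: eq_bigr => l _.
rewrite RintegralZr// ?RintegralZl ?mxE//.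
exact: integrableZl _ (intf l k).
Qed.

Lemma Emx_quadform {q : nat} (f : T -> 'M[R]_q) (v : 'cV[R]_q) : mx_integrable D f ->
  D.-integrable setT (EFin \o (fun s => quadform (f s) v)) /\
  \int[D]_(s in setT) quadform (f s) v = quadform (Emx D f) v.
Proof.
move=> intf.
have int1 i j : D.-integrable setT (EFin \o (fun s => f s i j * (v i 0 * v j 0))).
  exact: integrableZr (intf i j).
have intj i := Rintegral_sum _ (index_enum _) _ (int1 i).
have := Rintegral_sum _ (index_enum _) _ (fun i => (intj i).1).
under [X in _.-integrable _ (_ \o X)]eq_fun do rewrite -quadformE.
under eq_Rintegral do rewrite -quadformE.
move=> [intq ->]; split=> //; rewrite quadformE; apply: eq_bigr => i _.
rewrite (intj i).2; apply: eq_bigr => j _.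
by rewrite RintegralZr// mxE.
Qed.

Lemma Emx_psd {q : nat} (f : T -> 'M[R]_q) : mx_integrable D f ->
  (forall s, psd (f s)) -> psd (Emx D f).
Proof.
move=> intf pf; split=> [|v].
  apply/matrixP => i j; rewrite !mxE; apply: eq_Rintegral => s _.
  by rewrite -[in LHS](pf s).1 mxE.
by rewrite -(Emx_quadform _ v intf).2; apply: Rintegral_ge0 => s _; exact: (pf s).2.
Qed.

End matrix_expectation.

(** * Averaging out a sample that is independent of the past *)

Section fresh_sample.
Context {d d' : measure_display} {T : measurableType d} {T' : measurableType d'}.
Context {R : realType} (P : probability T R) (D : probability T' R).
Variables (C : set (set T)) (Cm : C `<=` measurable) (CI : setI_closed C) (CT : C setT).
Variables (X : T -> T') (mX : measurable_fun setT X).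
Hypothesis CX : forall A E, C A -> measurable E -> P (A `&` X @^-1` E) = (P A * D E)%E.

(** The same carrier [T] with the coarser sigma-algebra generated by the pi-system [C], standing for
    what is known before [X] is drawn. *)
Let past : measurableType _ := g_sigma_algebraType C.

Lemma measurable_past (A : set T) : measurable (A : set past) -> measurable A.
Proof. by apply: smallest_sub => //; exact: sigma_algebra_measurable. Qed.

Lemma past_fresh (A : set past) (E : set T') : measurable A -> measurable E ->
  P (A `&` X @^-1` E) = (P A * D E)%E.
Proof.
move=> mA mE.
have mXE : measurable (X @^-1` E) by rewrite -[X in measurable X]setTI; exact: mX.
have DE : D E = (fine (D E))%:E by rewrite fineK// fin_num_measure.
have DE0 : 0 <= fine (D E) by rewrite fine_ge0.
pose m1 : {measure set T -> \bar R} := mrestr P mXE.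
pose m2 : {measure set T -> \bar R} := mscale (NngNum DE0) P.
transitivity (m2 A); last by rewrite /m2 /= /mscale/= -DE muleC.
apply: (@g_sigma_algebra_measure_unique _ _ _ C Cm (fun=> setT) _ _ m1 m2) => //.
- by rewrite bigcup_const.
- by move=> B CB; rewrite /m1 /m2 /= /mscale /mrestr /= CX// DE muleC.
- by move=> _; rewrite /m1/= /mrestr setTI (le_lt_trans (probability_le1 _ _))// ltry.
Qed.

(* The law of [w |-> (w, X w)] on [past * T'] is the product of [P] and [D]. *)
Lemma integral_fresh (f : past * T' -> \bar R) :
  measurable_fun setT f -> (forall z, 0 <= f z)%E ->
  (\int[P]_w f (w, X w) = \int[P]_w \int[D]_s f (w, s))%E.
Proof.
move=> mf f0.
(* Coarseness of [past] makes the identity measurable, so [P] has an image law [Pp] on [past]. *)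
have mid : @measurable_fun _ _ T past setT idfun.
  by move=> _ A mA; rewrite setTI; exact: measurable_past.
pose id1 : {mfun T >-> past} :=
  HB.pack (idfun : T -> past) (isMeasurableFun.Build _ _ _ _ _ mid).
pose Pp : probability past R := distribution P id1.
have mphi : @measurable_fun _ _ T (past * T')%type setT (fun w => (w, X w)).
  exact: (measurable_fun_pair mid mX).
pose phi : {mfun T >-> (past * T')%type} :=
  HB.pack (fun w : T => (w : past, X w)) (isMeasurableFun.Build _ _ _ _ _ mphi).
pose Q : probability (past * T')%type R := distribution P phi.
have QE (Y : set (past * T')) : measurable Y -> (Pp \x D)%E Y = Q Y.
  apply: product_measure_unique => A E mA mE.
  exact: past_fresh.
transitivity (\int[Q]_z f z)%E.
  by rewrite (ge0_integral_pushforward mphi)//= preimage_setT.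
transitivity (\int[Pp \x D]_z f z)%E.
  by apply: eq_measure_integral => Y mY _; exact/esym/QE.
rewrite fubini_tonelli1// (ge0_integral_pushforward mid) ?preimage_setT//.
  exact: measurable_fun_fubini_tonelli_F.
by move=> w _; exact: integral_ge0.
Qed.

End fresh_sample.

(** * The past of an independent sequence *)

Section independent_past.
Context {d d' : measure_display} {T : measurableType d} {T' : measurableType d'}.
Context {R : realType} (P : probability T R) (X : nat -> {RV P >-> T'}).
Hypothesis indepX : mutually_independent X.

(** A pi-system generating the sigma-algebra of the samples [X i] with [i < k]; [E] is total, but
    its values from [k] on impose nothing. *)
Definition cylinders (k : nat) : set (set T) :=
  [set A | exists E : nat -> set T', (forall i, measurable (E i)) /\
    A = \bigcap_(i in [set` iota 0 k]) X i @^-1` E i].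

Lemma cylinders_measurable k : cylinders k `<=` measurable.
Proof.
move=> _ [E [mE ->]]; apply: bigcap_measurableType => i _.
by rewrite -[Y in measurable Y]setTI; exact: measurable_funP.
Qed.

Lemma cylinders_setI k : setI_closed (cylinders k).
Proof.
move=> _ _ [E [mE ->]] [F [mF ->]]; exists (fun i => E i `&` F i); split.
  by move=> i; exact: measurableI.
by rewrite -bigcapI.
Qed.

Lemma cylinders_setT k : cylinders k setT.
Proof.
exists (fun=> setT); split=> //.
by apply/esym; rewrite -subTset => w _ i _.
Qed.

Lemma cylinders_sample k i : (i < k)%N ->
  measurable_fun setT (X i : g_sigma_algebraType (cylinders k) -> T').
Proof.
move=> ik _ E mE; rewrite setTI; apply: sub_sigma_algebra.
exists (fun j => if j == i then E else setT); split=> [j|]; first by case: ifP.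
apply/seteqP; split=> [w XE j _ /=|w /(_ i)/=]; first by case: eqP => // ->.
by rewrite eqxx; apply; rewrite mem_iota.
Qed.

(** Adding an event on [X k] to a cylinder of length [k] gives one of length [k.+1]. Mutual
    independence factors both, and the last factor splits off. *)
Lemma cylinders_fresh k A E : cylinders k A -> measurable E ->
  P (A `&` X k @^-1` E) = (P A * P (X k @^-1` E))%E.
Proof.
move=> [F [mF ->]] mE; pose F' i := if i == k then E else F i.
have memI j i : [set` iota 0 j] i = (i < j)%N :> Prop.
  by rewrite /mkset mem_iota add0n.
have mF' i : measurable (F' i) by rewrite /F'; case: ifP.
have -> : \bigcap_(i in [set` iota 0 k]) X i @^-1` F i `&` X k @^-1` E =
    \bigcap_(i in [set` iota 0 k.+1]) X i @^-1` F' i.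
  apply/seteqP; split=> [w [AF EF] i|w AF].
    rewrite memI ltnS leq_eqVlt /F' /preimage/=; case: eqP => [->//|_ /= ik].
    by apply: AF; rewrite memI.
  split=> [i|]; last by have := AF k; rewrite memI /F' /= eqxx; exact.
  by rewrite memI => ik; have := AF i; rewrite memI /F' ltn_eqF// ltnS ltnW//; exact.
rewrite !indepX ?iota_uniq// -addn1 iotaD big_cat/= add0n big_seq1 {2}/F' eqxx.
congr (_ * _)%E; apply: eq_big_seq => i; rewrite mem_iota add0n => ik.
by rewrite /F' ltn_eqF.
Qed.

End independent_past.

(** * Convergence *)

Section contraction.
Context {R : realType} {m n p : nat}.
Variables (A : 'M[R]_(m, n.+1)) (B : 'M[R]_n.+1) (G : 'M[R]_p) (rho : R).
Hypotheses (spdB : spd B) (spdG : spd G) (rho_gt0 : 0 < rho) (A_neq0 : A != 0).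
Variable D : probability (borel_mx R m p) R.
Hypotheses (int_SHS : mx_integrable D (SHSmx A B G rho))
  (int_Z : mx_integrable D (Zmx A B G rho))
  (int_ZG : mx_integrable D (ZGmx A B G rho))
  (null_SHS : null_space (Emx D (SHSmx A B G rho)) `<=` null_space A^T).

Local Notation EZ := (Emx D (Zmx A B G rho)).
Local Notation EZG := (Emx D (ZGmx A B G rho)).
Local Notation Ci := (invsqrtmx B).
Local Notation M := (Emx D (fun s => Ci *m Zmx A B G rho s *m Ci)).
Local Notation MG := (Ci *m EZG *m Ci).
Local Notation eta_max := (lambda_max M).
Local Notation mu_min := (lambda_minp M).
Local Notation mu0 := (lambda_min MG).
Local Notation rate := (1 - mu_min - mu0 / rho).

Let psd_EZ : psd EZ. Proof. exact/Emx_psd/psd_Z. Qed.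
Let psd_EZG : psd EZG. Proof. exact/Emx_psd/psd_ZG. Qed.

(** Since [EZ = A^T E[SHS^T] A], the semidefinite [E[SHS^T]] kills [A v]. The null space condition
    then gives [A^T A v = 0], hence [A v = 0]. *)
Lemma EZ_null (v : 'cV[R]_n.+1) : EZ *m v = 0 -> A *m v = 0.
Proof.
move=> EZv; have psd_ESHS : psd (Emx D (SHSmx A B G rho)) by exact/Emx_psd/psd_SHS.
have EZE : EZ = A^T *m Emx D (SHSmx A B G rho) *m A.
  rewrite -Emx_mulmx//; congr Emx; apply/funext => s; exact: ZE.
have : quadform (Emx D (SHSmx A B G rho)) (A *m v) = 0.
  by rewrite quadform_mulmx -EZE /quadform -mulmxA EZv mulmx0 mxE.
move=> /(psd_eq0 _ _ psd_ESHS)/null_SHS; rewrite /null_space/= => AAv.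
apply/eqP; rewrite -quadform1_eq0 quadform_mulmx mulmx1 /quadform -!mulmxA AAv.
by rewrite mulmx0 mxE.
Qed.

Lemma step_expectation (r : 'cV[R]_n.+1) :
  (\int[D]_s (quadform B ((1%:M - invmx B *m Zmx A B G rho s) *m r))%:E =
   (quadform B r - quadform EZ r - rho^-1 * quadform EZG r)%:E)%E.
Proof.
have [iZ eZ] := Emx_quadform _ _ r int_Z.
have [iG eG] := Emx_quadform _ _ r int_ZG.
have iB : D.-integrable setT (EFin \o fun=> quadform B r).
  exact: finite_measure_integrable_cst.
have iG' := integrableZl measurableT rho^-1 iG.
have iBZ := integrableB measurableT iB iZ.
under eq_integral do rewrite (ps_error_quadform _ _ _ _ spdB spdG rho_gt0).
pose F s := quadform B r - quadform (Zmx A B G rho s) r -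
  rho^-1 * quadform (ZGmx A B G rho s) r.
have iF : D.-integrable setT (EFin \o F) := integrableB measurableT iBZ iG'.
transitivity (\int[D]_(s in setT) F s)%:E.
  by rewrite /Rintegral fineK// integrable_fin_num.
congr EFin; rewrite RintegralB// RintegralB// RintegralZl// eZ eG Rintegral_cst//.
congr (_ - _ - _); rewrite -[RHS]mulr1; congr (_ * _).
exact: (congr1 fine (probability_setT D)).
Qed.

(** Change of variable by [invmx Ci], which is [B^(1/2)]; it turns the [B]-norm into the Euclidean
    one. *)
Lemma quadform_invsqrt (K : 'M[R]_n.+1) (r : 'cV[R]_n.+1) :
  quadform K r = quadform (Ci *m K *m Ci) (invmx Ci *m r).
Proof.
have [C [sC CC ->]] := invsqrtmxE _ spdB; have Cu := spd_unitmx _ sC.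
rewrite quadform_mulmx invmxK sC.1 !mulmxA mulmxV// mul1mx.
by rewrite -!mulmxA mulVmx// mulmx1.
Qed.

Lemma quadform_invsqrt1 (r : 'cV[R]_n.+1) :
  quadform B r = quadform 1%:M (invmx Ci *m r).
Proof.
rewrite quadform_invsqrt; congr quadform.
have [C [sC CC ->]] := invsqrtmxE _ spdB; have Cu := spd_unitmx _ sC.
by rewrite -CC mulmxA mulVmx// mul1mx mulmxV.
Qed.

Let ME : M = Ci *m EZ *m Ci. Proof. exact: Emx_mulmx. Qed.

Let Ci_sym : Ci^T = Ci.
Proof. by have [C [sC CC ->]] := invsqrtmxE _ spdB; rewrite invmx_sym// sC.1. Qed.

Let psd_M : psd M.
Proof. by rewrite ME -{1}Ci_sym; exact: psd_mulmx. Qed.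

Let psd_MG : psd MG.
Proof. by rewrite -{1}Ci_sym; exact: psd_mulmx. Qed.

(** Dual form of [EZ_null]: the range of [A^T] lies in that of the symmetric matrix [EZ]. *)
Let A_factor : exists Y, A^T = EZ *m Y.
Proof.
have [Y AE] := row_factor _ _ EZ_null; exists Y^T.
by transitivity ((Y *m EZ)^T); [rewrite -AE | rewrite trmx_mul psd_EZ.1].
Qed.

Lemma mu_min_gt0 : 0 < mu_min.
Proof.
apply: lambda_minp_gt0 => //; apply: contra_neq A_neq0 => M0.
have [C [sC CC CiE]] := invsqrtmxE _ spdB; have Cu := spd_unitmx _ sC.
have EZ0 : EZ = 0.
  have -> : EZ = C *m M *m C.
    by rewrite ME CiE !mulmxA mulmxV// mul1mx -mulmxA mulVmx// mulmx1.
  by rewrite M0 mulmx0 mul0mx.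
by have [Y AE] := A_factor; apply: trmx_inj; rewrite AE EZ0 mul0mx trmx0.
Qed.

Lemma mu0_ge0 : 0 <= mu0. Proof. exact: lambda_min_ge0. Qed.

Lemma eta_max_ge0 : 0 <= eta_max. Proof. exact: lambda_max_ge0. Qed.

Lemma quadform_EZ_le (r : 'cV[R]_n.+1) : quadform EZ r <= eta_max * quadform B r.
Proof.
by rewrite (quadform_invsqrt EZ) -ME quadform_invsqrt1 lambda_max_quadform// psd_M.1.
Qed.

Lemma step_rate (y : 'cV[R]_m) (r := invmx B *m A^T *m y) :
  quadform B r - quadform EZ r - rho^-1 * quadform EZG r <= rate * quadform B r.
Proof.
have [Y AE] := A_factor; have [C [sC CC CiE]] := invsqrtmxE _ spdB.
have Cu := spd_unitmx _ sC; have Bu := spd_unitmx _ spdB.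
have CB : C *m invmx B = Ci by rewrite CiE -[in RHS](mulmxK Bu (invmx C)) -CC mulKmx.
(* This puts [B^(1/2) r] in the range of [M], where [lambda_minp] bounds the Rayleigh quotient. For
   [mu0], an ordinary smallest eigenvalue, any vector will do. *)
have rE : invmx Ci *m r = M *m (C *m Y *m y).
  by rewrite /r AE ME CiE invmxK !mulmxA CB CiE mulmxKV.
have h1 : mu_min * quadform B r <= quadform EZ r.
  rewrite quadform_invsqrt1 (quadform_invsqrt EZ) -ME rE.
  exact: lambda_minp_quadform psd_M.1 _.
have h2 : mu0 * quadform B r <= quadform EZG r.
  rewrite quadform_invsqrt1 (quadform_invsqrt EZG).
  exact: lambda_min_quadform psd_MG.1 _.
have rho_inv : 0 <= rho^-1 by rewrite invr_ge0 ltW.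
have h3 := ler_wpM2l rho_inv h2.
have -> : rate * quadform B r =
    quadform B r - mu_min * quadform B r - rho^-1 * (mu0 * quadform B r).
  by rewrite 2!mulrBl mul1r [mu0 / rho]mulrC -mulrA.
exact: (lerB (lerB (lexx _) h1) h3).
Qed.

Lemma rate_lt1 : rate < 1.
Proof.
have := mu_min_gt0; have : 0 <= mu0 / rho by rewrite divr_ge0// ?mu0_ge0 ?ltW.
lra.
Qed.

(* [rate] is bounded below by a ratio of nonnegative expected squared errors. *)
Lemma rate_ge0 : 0 <= rate.
Proof.
(* A nonzero vector to divide by: were there none, all columns of [B^-1 A^T] would vanish and [A]
   would be 0. *)
have [y r0] : exists y : 'cV[R]_m, invmx B *m A^T *m y != 0.
  apply: contrapT => /forallNP y0; move: A_neq0; apply/negP/negPn/eqP/trmx_inj.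
  have Bu := spd_unitmx _ spdB.
  rewrite trmx0 -(mulKVmx Bu A^T).
  suff -> : invmx B *m A^T = 0 by rewrite mulmx0.
  apply/matrixP => i j; rewrite [RHS]mxE; have /negP/negPn/eqP := y0 (delta_mx j 0).
  by rewrite -colE => /colP/(_ i); rewrite mxE [RHS]mxE.
have := step_rate y; set r := _ *m y in r0 *.
rewrite -(pmulr_lge0 _ (spdB.2 _ r0)); apply: le_trans.
rewrite -lee_fin -step_expectation; apply: integral_ge0 => s _.
by rewrite lee_fin; case: (spd_psd _ spdB).
Qed.

End contraction.

Lemma measurable_quadform {d : measure_display} {T : measurableType d} {R : realType}
    {n : nat} (K : 'M[R]_n) (u : T -> 'cV[R]_n) :
  (forall i, measurable_fun setT (fun w => u w i 0)) ->
  measurable_fun setT (fun w => quadform K (u w)).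
Proof.
move=> mu; under eq_fun do rewrite quadformE.
apply: measurable_sum => i; apply: measurable_sum => j.
exact: measurable_funM (measurable_funM _ _).
Qed.

(** * The error recursion: range and measurability *)

Section iterates.
Context {R : realType} {m n p : nat}.
Variables (A : 'M[R]_(m, n)) (B : 'M[R]_n) (G : 'M[R]_p) (rho : R).

Definition error_map (S : 'M[R]_(m, p)) : 'M[R]_n := 1%:M - invmx B *m Zmx A B G rho S.

Fixpoint ps_error (e0 : 'cV[R]_n) (S : nat -> 'M[R]_(m, p)) (k : nat) : 'cV[R]_n :=
  if k is k'.+1 then error_map (S k') *m ps_error e0 S k' else e0.

Lemma ps_iter_error b x0 xs S k : A *m xs = b ->
  ps_iter A b B G rho x0 S k - xs = ps_error (x0 - xs) S k.
Proof.
by move=> Axs; elim: k => //= k IH; rewrite (ps_step_error _ _ _ _ _ _ _ _ Axs) IH.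
Qed.

Lemma ps_error_range e0 S k : (exists y, e0 = invmx B *m A^T *m y) ->
  exists y, ps_error e0 S k = invmx B *m A^T *m y.
Proof.
move=> e0E; elim: k => //= k [y ->].
exists (y - S k *m Hmx A B G rho (S k) *m (S k)^T *m A *m (invmx B *m A^T *m y)).
by rewrite /error_map mulmxBl mul1mx [RHS]mulmxBr /Zmx !mulmxA.
Qed.

Lemma measurable_error_step {d : measure_display} {T : measurableType d}
    (X : T -> borel_mx R m p) (u : T -> 'cV[R]_n) :
  (forall i j, measurable_fun setT (fun s : borel_mx R m p => Zmx A B G rho s i j)) ->
  measurable_fun setT X -> (forall i, measurable_fun setT (fun w => u w i 0)) ->
  forall i, measurable_fun setT (fun w => (error_map (X w) *m u w) i 0).
Proof.
move=> mZ mX mu i; under eq_fun do rewrite mxE.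
apply: measurable_sum => j; apply: measurable_funM => //.
under eq_fun do rewrite !mxE.
apply: measurable_funB; first exact: measurable_cst.
apply: measurable_sum => l; apply: measurable_funM; first exact: measurable_cst.
exact: measurableT_comp (mZ l j) mX.
Qed.

(** Asking measurability only of the samples below [k] lets the lemma apply on the coarser [past] as
    well as on the whole probability space. *)
Lemma measurable_ps_error {d : measure_display} {T : measurableType d}
    (X : nat -> T -> borel_mx R m p) (e0 : 'cV[R]_n) (k : nat) :
  (forall i j, measurable_fun setT (fun s : borel_mx R m p => Zmx A B G rho s i j)) ->
  (forall i, (i < k)%N -> measurable_fun setT (X i)) ->
  forall i, measurable_fun setT (fun w => ps_error e0 (fun j => X j w) k i 0).
Proof.
move=> mZ; elim: k => [|k IH] mX i; first exact: measurable_cst.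
apply: measurable_error_step => //; first exact: mX.
by apply: IH => j jk; apply: mX; rewrite ltnS ltnW.
Qed.

End iterates.

(** * Geometric decay of the expected errors *)

Section convergence.
Context {R : realType} {m n p : nat}.
Variables (A : 'M[R]_(m, n.+1)) (B : 'M[R]_n.+1) (G : 'M[R]_p) (rho : R).
Hypotheses (spdB : spd B) (spdG : spd G) (rho_gt0 : 0 < rho) (A_neq0 : A != 0).
Variable D : probability (borel_mx R m p) R.
Hypotheses (int_SHS : mx_integrable D (SHSmx A B G rho))
  (int_Z : mx_integrable D (Zmx A B G rho))
  (int_ZG : mx_integrable D (ZGmx A B G rho))
  (null_SHS : null_space (Emx D (SHSmx A B G rho)) `<=` null_space A^T).
Context {d : measure_display} {Omega : measurableType d} (P : probability Omega R).
Variable S : nat -> {RV P >-> borel_mx R m p}.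
Hypotheses (law_S : forall k E, measurable E -> distribution P (S k) E = D E)
  (indep_S : mutually_independent S).
Variable e0 : 'cV[R]_n.+1.
Hypothesis e0_range : exists y, e0 = invmx B *m A^T *m y.

Local Notation M :=
  (Emx D (fun s => invsqrtmx B *m Zmx A B G rho s *m invsqrtmx B)).
Local Notation eta_max := (lambda_max M).
Local Notation mu_min := (lambda_minp M).
Local Notation mu0 := (lambda_min (invsqrtmx B *m Emx D (ZGmx A B G rho) *m invsqrtmx B)).
Local Notation rate := (1 - mu_min - mu0 / rho).
Local Notation e k w := (ps_error A B G rho e0 (fun i => S i w) k).

Let mZ i j : measurable_fun setT (fun s : borel_mx R m p => Zmx A B G rho s i j).
Proof. exact/measurable_EFinP/measurable_int/int_Z. Qed.

Let me k K : measurable_fun setT (fun w => (quadform K (e k w))%:E).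
Proof.
apply/measurable_EFinP/measurable_quadform => i.
exact: (measurable_ps_error _ _ _ _ (fun j => S j : Omega -> borel_mx R m p)).
Qed.

Let rate_nneg : 0 <= rate.
Proof.
exact: (rate_ge0 A B G rho spdB spdG rho_gt0 A_neq0 D int_SHS int_Z int_ZG null_SHS).
Qed.

Let rate_small : rate < 1.
Proof.
exact: (rate_lt1 A B G rho spdB spdG rho_gt0 A_neq0 D int_SHS int_Z int_ZG null_SHS).
Qed.

Let B_ge0 v : 0 <= quadform B v. Proof. by case: (spd_psd _ spdB). Qed.

Lemma expected_error_step k :
  (\int[P]_w (quadform B (e k.+1 w))%:E <=
   rate%:E * \int[P]_w (quadform B (e k w))%:E)%E.
Proof.
pose C := cylinders P S k.
pose past : measurableType _ := g_sigma_algebraType C.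
(* The two sources of randomness are separated: [z.1] determines the current error and [z.2] is the
   fresh sample. *)
pose f (z : past * borel_mx R m p) :=
  (quadform B (error_map A B G rho z.2 *m e k z.1))%:E.
have mf : @measurable_fun _ _ (past * borel_mx R m p)%type _ setT f.
  apply/measurable_EFinP/measurable_quadform.
  apply: (@measurable_error_step _ _ _ _ A B G rho _ (past * borel_mx R m p)%type
    snd (fun z => e k z.1) mZ measurable_snd) => i.
  have h := @measurable_ps_error _ _ _ _ A B G rho _ past
    (fun j => S j : past -> borel_mx R m p) e0 k mZ (cylinders_sample P S k) i.
  exact: measurableT_comp h measurable_fst.
have -> : (\int[P]_w (quadform B (e k.+1 w))%:E = \int[P]_w \int[D]_s f (w, s))%E.
  apply: (@integral_fresh _ _ _ _ _ P D C (@cylinders_measurable _ _ _ _ _ P S k)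
    (@cylinders_setI _ _ _ _ _ P S k) (@cylinders_setT _ _ _ _ _ P S k) (S k) _ _ f mf).
  - exact: measurable_funP.
  - move=> X E CX mE; rewrite (cylinders_fresh P S indep_S _ _ _ CX mE).
    by congr (_ * _)%E; exact: law_S.
  - by move=> z; rewrite /f lee_fin.
pose g w := quadform B (e k w) - quadform (Emx D (Zmx A B G rho)) (e k w) -
  rho^-1 * quadform (Emx D (ZGmx A B G rho)) (e k w).
have stepE w : (\int[D]_s f (w, s) = (g w)%:E)%E.
  exact: (step_expectation A B G rho spdB spdG rho_gt0 D int_Z int_ZG (e k w)).
have -> : (\int[P]_w \int[D]_s f (w, s) = \int[P]_w (g w)%:E)%E.
  by apply: eq_integral => w _; exact: stepE.
rewrite -ge0_integralZl_EFin//; last by move=> w _; rewrite lee_fin.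
apply: ge0_le_integral => //.
(* Nonnegativity of [g] is not visible from its formula; it holds because [g w] is an expected
   squared error. *)
- move=> w _; rewrite -stepE; apply: integral_ge0 => s _.
  by rewrite /f lee_fin.
- have mq K : measurable_fun setT (fun w => quadform K (e k w)).
    exact/measurable_EFinP/me.
  apply/measurable_EFinP/measurable_funB; first exact: measurable_funB.
  exact: measurable_funM.
- exact: measurable_funeM.
move=> w _; rewrite -EFinM lee_fin /g.
have [y ->] := ps_error_range A B G rho e0 (fun i => S i w) k e0_range.
exact: (step_rate A B G rho spdB spdG rho_gt0 D int_SHS int_Z int_ZG null_SHS y).
Qed.

Lemma expected_error k :
  (\int[P]_w (quadform B (e k w))%:E <= (rate ^+ k)%:E * (quadform B e0)%:E)%E.
Proof.
elim: k => [|k IH].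
  rewrite expr0 mul1e; have := expectation_cst P (quadform B e0).
  by rewrite unlock => /= ->.
apply: (le_trans (expected_error_step k)).
(* Multiplying the induction hypothesis by [rate] relies on [rate_nneg]. *)
by rewrite exprS EFinM -muleA; apply: lee_wpmul2l.
Qed.

(** The comparison [quadform_EZ_le] holds pointwise, so it integrates and reduces the claim to
    [expected_error]. *)
Lemma expected_EZ_error k :
  (\int[P]_w (quadform (Emx D (Zmx A B G rho)) (e k w))%:E <=
   (eta_max * rate ^+ k)%:E * (quadform B e0)%:E)%E.
Proof.
have eta0 : 0 <= eta_max by exact: (eta_max_ge0 A B G rho spdB spdG rho_gt0 D int_Z).
apply: (@le_trans _ _ (eta_max%:E * \int[P]_w (quadform B (e k w))%:E)%E); last first.
  rewrite EFinM -muleA; apply: lee_wpmul2l; first by rewrite lee_fin.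
  exact: expected_error.
rewrite -ge0_integralZl_EFin//; last by move=> w _; rewrite lee_fin.
apply: ge0_le_integral => //.
- move=> w _; rewrite lee_fin.
  by case: (Emx_psd _ _ int_Z (psd_Z _ _ _ _ spdB spdG rho_gt0)).
- exact: measurable_funeM.
move=> w _; rewrite -EFinM lee_fin.
exact: (quadform_EZ_le A B G rho spdB spdG rho_gt0 D int_Z).
Qed.

Lemma expected_error_cvg :
  (fun k => \int[P]_w (quadform B (e k w))%:E)%E @ \oo --> 0%E.
Proof.
apply: (@squeeze_cvge _ _ _ _ (cst 0%E) _ (fun k => (rate ^+ k * quadform B e0)%:E)).
- apply: nearW => k; rewrite EFinM expected_error andbT.
  by apply: integral_ge0 => w _; rewrite lee_fin.
- exact: cvg_cst.
apply: cvg_EFin; first exact: nearW.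
rewrite -[X in _ --> X](mul0r (quadform B e0)); apply: cvgMr_tmp.
by apply: cvg_expr; rewrite ger0_norm.
Qed.

End convergence.

Theorem theorem3p5 (R : realType) (m n p : nat)
    (m_gt0 : (0 < m)%N) (n_gt0 : (0 < n)%N) (p_gt0 : (0 < p)%N)
    (A : 'M[R]_(m, n)) (b : 'cV[R]_m)
    (consistent : exists x : 'cV[R]_n, A *m x = b)
    (B : 'M[R]_n) (G : 'M[R]_p) (spdB : spd B) (spdG : spd G)
    (rho : R) (rho_gt0 : 0 < rho)
    (D : probability (borel_mx R m p) R)
    (int_SHS : mx_integrable D (SHSmx A B G rho))
    (int_W : mx_integrable D (Wmx A B G rho))
    (int_Z : mx_integrable D (Zmx A B G rho))
    (int_ZG : mx_integrable D (ZGmx A B G rho))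
    (null_SHS : null_space (Emx D (SHSmx A B G rho)) `<=` null_space A^T)
    (spd_W : spd (Emx D (Wmx A B G rho)))
    (d : measure_display) (Omega : measurableType d) (P : probability Omega R)
    (S : nat -> {RV P >-> borel_mx R m p})
    (law_S : forall k E, measurable E -> distribution P (S k) E = D E)
    (indep_S : mutually_independent S)
    (x0 : 'cV[R]_n) :
  let x (k : nat) (w : Omega) : 'cV[R]_n :=
    ps_iter A b B G rho x0 (fun i => S i w) k in
  let xstar := Bproj A b B x0 in
  let Bm12 := invsqrtmx B in
  let mu_min :=
    lambda_minp (Emx D (fun s => Bm12 *m Zmx A B G rho s *m Bm12)) in
  let eta_max :=
    lambda_max (Emx D (fun s => Bm12 *m Zmx A B G rho s *m Bm12)) in
  let mu0 := lambda_min (Bm12 *m Emx D (ZGmx A B G rho) *m Bm12) in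
  [/\ (fun k => 'E_P[fun w => quadform B (x k w - xstar)]%E) @ \oo --> 0%E,
      forall k : nat,
        ('E_P[fun w => quadform B (x k.+1 w - xstar)] <=
         ((1 - mu_min - mu0 / rho) ^+ k.+1)%:E
           * 'E_P[fun w => quadform B (x 0%N w - xstar)])%E
    & forall k : nat,
        ('E_P[fun w => quadform (Emx D (Zmx A B G rho)) (x k.+1 w - xstar)] <=
         (eta_max * (1 - mu_min - mu0 / rho) ^+ k.+1)%:E
           * 'E_P[fun w => quadform B (x 0%N w - xstar)])%E].
Proof.
move=> x xstar Bm12 mu_min eta_max mu0; destruct n as [|n'] => //.
(* If [A] were 0, then [E[W]] would be 0, contradicting its definiteness at a basis vector, which
   exists because [p] is positive. *)
have A_neq0 : A != 0.
  apply/eqP => A0; have [_ Wpos] := spd_W.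
  have EW0 : Emx D (Wmx A B G rho) = 0.
    apply/matrixP => i j; rewrite !mxE.
    rewrite (_ : (fun s => _) = cst 0) ?Rintegral_cst// ?mul0r//.
    by apply/funext => s; rewrite /Wmx A0 mulmx0 !mul0mx mxE.
  pose v : 'cV[R]_p := delta_mx (Ordinal p_gt0) 0.
  have v0 : v != 0.
    apply/eqP => /colP/(_ (Ordinal p_gt0)); rewrite !mxE !eqxx => /eqP.
    by rewrite oner_eq0.
  by have := Wpos v v0; rewrite EW0 /quadform mulmx0 mul0mx mxE ltxx.
have [Axs e0E] := Bproj_spec A b B spdB x0 consistent.
have EE K k : 'E_P[fun w => quadform K (x k w - xstar)]%E =
    (\int[P]_w (quadform K (ps_error A B G rho (x0 - xstar) (fun i => S i w) k))%:E)%E.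
  rewrite unlock; apply: eq_integral => w _.
  by rewrite /x (ps_iter_error _ _ _ _ _ _ _ _ _ Axs).
have E0 : 'E_P[fun w => quadform B (x 0%N w - xstar)]%E = (quadform B (x0 - xstar))%:E.
  exact: (expectation_cst P (quadform B (x0 - xstar))).
rewrite E0; split.
- under eq_fun do rewrite EE.
  exact: (expected_error_cvg A B G rho spdB spdG rho_gt0 A_neq0 D int_SHS int_Z int_ZG
    null_SHS P S law_S indep_S _ e0E).
- move=> k; rewrite EE.
  exact: (expected_error A B G rho spdB spdG rho_gt0 A_neq0 D int_SHS int_Z int_ZG
    null_SHS P S law_S indep_S _ e0E).
move=> k; rewrite EE.
exact: (expected_EZ_error A B G rho spdB spdG rho_gt0 A_neq0 D int_SHS int_Z int_ZG
  null_SHS P S law_S indep_S _ e0E).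
Qed.
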